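(* Let $(M\xrightarrow{\partial}N,\cdot,\{-,-\})$ be a braided crossed module of Lie $K$-algebras. Then the $K$-bilinear map $\langle\!\langle-,-\rangle\!\rangle\colon(N\otimes N)\times(N\otimes N)\to N\otimes M$ defined on generators by $$\langle\!\langle n\otimes n',n''\otimes n'''\rangle\!\rangle=[n,n']\otimes\{n'',n'''\}$$ is (well defined and) a braiding on the crossed module of Lie $K$-algebras $(N\otimes M\xrightarrow{\mathrm{Id}_N\otimes\partial}N\otimes N,* )$.
   Context: $K$ is a fixed field; all Lie algebras and Lie homomorphisms are over $K$. A crossed module of Lie algebras $(M\xrightarrow{\partial}N,\cdot)$ consists of a Lie action of $N$ on $M$, i.e. a $K$-bilinear map $\cdot\colon N\times M\to M$ with $[n,n']\cdot m=n\cdot(n'\cdot m)-n'\cdot(n\cdot m)$ and $n\cdot[m,m']=[n\cdot m,m']+[m,n\cdot m']$, and a Lie homomorphism $\partial\colon M\to N$ with $\partial(n\cdot m)=[n,\partial(m)]$ and $\partial(m)\cdot m'=[m,m']$. A braiding on it is a $K$-bilinear map $\{-,-\}\colon N\times N\to M$ such that, for all $m,m'\in M$, $n,n',n''\in N$: $\partial\{n,n'\}=[n,n']$; $\{\partial m,\partial m'\}=[m,m']$; $\{\partial m,n\}=-n\cdot m$; $\{n,\partial m\}=n\cdot m$; $\{n,[n',n'']\}=\{[n,n'],n''\}-\{[n,n''],n'\}$; $\{[n,n'],n''\}=\{n,[n',n'']\}-\{n',[n,n'']\}$. Then $(M\xrightarrow{\partial}N,\cdot,\{-,-\})$ is a braided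 crossed module. Non-abelian tensor product: let $A,B$ be Lie algebras with $A$ acting on $B$ (written $a\cdot b$) and $B$ acting on $A$ (written $b\star a$). $A\otimes B$ is the Lie $K$-algebra generated by symbols $a\otimes b$ subject to: $K$-bilinearity of $(a,b)\mapsto a\otimes b$; $[a,a']\otimes b=a\otimes(a'\cdot b)-a'\otimes(a\cdot b)$; $a\otimes[b,b']=(b'\star a)\otimes b-(b\star a)\otimes b'$; $[a\otimes b,a'\otimes b']=-(b\star a)\otimes(a'\cdot b')$. $N\otimes N$ is formed with the adjoint actions of $N$ on itself. $N\otimes M$ is formed with the given action of $N$ on $M$ and the action $m\star n=[\partial(m),n]$ of $M$ on $N$. The crossed module $(N\otimes M\xrightarrow{\mathrm{Id}_N\otimes\partial}N\otimes N,* )$ (known, due to Casas and Ladra) has $(\mathrm{Id}_N\otimes\partial)(n\otimes m)=n\otimes\partial(m)$ and action $(n\otimes n')*(n''\otimes m)=[[n,n'],n'']\otimes m+n''\otimes([n,n']\cdot m)$. *)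

(* Defs.v *)
From HB Require Import structures.
From mathcomp Require Import all_boot all_order all_algebra.
From mathcomp Require Import sesquilinear boolp.

Set Implicit Arguments.
Unset Strict Implicit.
Unset Printing Implicit Defensive.

Import GRing.Theory.
Local Open Scope ring_scope.
Local Open Scope quotient_scope.

Reserved Notation "[ 'lie' x , y ]" (at level 0, format "[ 'lie'  x ,  y ]").

(* The bracket is alternating, which in characteristic 2 is stronger than     *)
(* antisymmetric.                                                             *)
HB.mixin Record Lmodule_isLieAlgebra (K : fieldType) L of GRing.Lmodule K L := {
  lie_br : L -> L -> L;
  lie_bilinear : bilinear_for *:%R *:%R lie_br;
  liexx : forall x, lie_br x x = 0;
  lie_jacobi : forall x y z,
    lie_br x (lie_br y z) + lie_br y (lie_br z x) + lie_br z (lie_br x y) = 0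
}.

#[short(type="lieAlgType")]
HB.structure Definition LieAlgebra (K : fieldType) :=
  {L of Lmodule_isLieAlgebra K L & GRing.Lmodule K L}.

Notation "[ 'lie' x , y ]" := (lie_br x y) : ring_scope.

HB.instance Definition _ (K : fieldType) (L : lieAlgType K) :=
  bilinear_isBilinear.Build K L L L *:%R *:%R (@lie_br K L) lie_bilinear.

Record lieHom (K : fieldType) (L L' : lieAlgType K) := LieHom {
  lie_hom :> {linear L -> L'};
  lie_homP : forall x y, lie_hom [lie x, y] = [lie lie_hom x, lie_hom y]
}.

Record lieAction (K : fieldType) (N M : lieAlgType K) := LieAction {
  act :> {bilinear N -> M -> M};
  act_liel : forall n n' m,
    act [lie n, n'] m = act n (act n' m) - act n' (act n m);
  act_lier : forall n m m',
    act n [lie m, m'] = [lie act n m, m'] + [lie m, act n m']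
}.

Record crossedModule (K : fieldType) (M N : lieAlgType K) := CrossedModule {
  xm_act : lieAction N M;
  xm_bd : lieHom M N;
  xm_equivariant : forall n m, xm_bd (xm_act n m) = [lie n, xm_bd m];
  xm_peiffer : forall m m', xm_act (xm_bd m) m' = [lie m, m']
}.

Record is_braiding (K : fieldType) (M N : lieAlgType K)
    (X : crossedModule M N) (br : {bilinear N -> N -> M}) : Prop := IsBraiding {
  bd_braid : forall n n', xm_bd X (br n n') = [lie n, n'];
  braid_bdbd : forall m m', br (xm_bd X m) (xm_bd X m') = [lie m, m'];
  braid_bdl : forall m n, br (xm_bd X m) n = - xm_act X n m;
  braid_bdr : forall n m, br n (xm_bd X m) = xm_act X n m;
  braid_lier : forall n n' n'',
    br n [lie n', n''] = br [lie n, n'] n'' - br [lie n, n''] n';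
  braid_liel : forall n n' n'',
    br [lie n, n'] n'' = br n [lie n', n''] - br n' [lie n, n'']
}.

Section LieTheory.
Variables (K : fieldType) (L : lieAlgType K).
Implicit Types x y z : L.

Lemma lieDl x y z : [lie x + y, z] = [lie x, z] + [lie y, z].
Proof. exact: linearDl. Qed.
Lemma lieDr x y z : [lie x, y + z] = [lie x, y] + [lie x, z].
Proof. exact: linearDr. Qed.
Lemma lieZl k x y : [lie k *: x, y] = k *: [lie x, y].
Proof. exact: linearZl_LR. Qed.
Lemma lieZr k x y : [lie x, k *: y] = k *: [lie x, y].
Proof. exact: linearZr_LR. Qed.
Lemma lie0l x : [lie 0, x] = 0. Proof. exact: linear0l. Qed.
Lemma lie0r x : [lie x, 0] = 0. Proof. exact: linear0r. Qed.
Lemma lieNl x y : [lie - x, y] = - [lie x, y]. Proof. exact: linearNl. Qed.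
Lemma lieNr x y : [lie x, - y] = - [lie x, y]. Proof. exact: linearNr. Qed.

Lemma lieC x y : [lie x, y] = - [lie y, x].
Proof.
have := liexx (x + y).
rewrite lieDl !lieDr !liexx add0r addr0 => /eqP.
by rewrite addr_eq0 => /eqP.
Qed.

Lemma lie_liel x y z :
  [lie [lie x, y], z] = [lie x, [lie y, z]] - [lie y, [lie x, z]].
Proof.
have := lie_jacobi x y z; rewrite (lieC z x) (lieC z [lie x, y]) lieNr.
by move/eqP; rewrite subr_eq0 => /eqP.
Qed.

Lemma lie_lier x y z :
  [lie x, [lie y, z]] = [lie [lie x, y], z] + [lie y, [lie x, z]].
Proof. by rewrite lie_liel subrK. Qed.

Definition adj_action : lieAction L L := LieAction lie_liel lie_lier.

End LieTheory.

Section HomTheory.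
Variables (K : fieldType) (L L' : lieAlgType K) (f : lieHom L L').

Lemma lhomD x y : f (x + y) = f x + f y. Proof. exact: linearD. Qed.
Lemma lhomZ k x : f (k *: x) = k *: f x. Proof. exact: linearZ. Qed.
Lemma lhom0 : f 0 = 0. Proof. exact: linear0. Qed.

End HomTheory.

Section ActionTheory.
Variables (K : fieldType) (N M : lieAlgType K) (f : lieAction N M).

Lemma actDl n n' m : f (n + n') m = f n m + f n' m. Proof. exact: linearDl. Qed.
Lemma actDr n m m' : f n (m + m') = f n m + f n m'. Proof. exact: linearDr. Qed.
Lemma actZl k n m : f (k *: n) m = k *: f n m. Proof. exact: linearZl_LR. Qed.
Lemma actZr k n m : f n (k *: m) = k *: f n m. Proof. exact: linearZr_LR. Qed.
Lemma actBl n n' m : f (n - n') m = f n m - f n' m. Proof. exact: linearBl. Qed.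

End ActionTheory.

Section NonabelianTensor.
Variables (K : fieldType) (A B : lieAlgType K).
Variables (ab : lieAction A B) (ba : lieAction B A).

(* The Lie algebra presented by the symbols a (x) b and the relations of the  *)
(* non-abelian tensor product: formal Lie algebra expressions in the symbols, *)
(* modulo the least congruence containing the Lie algebra axioms and these    *)
(* relations.                                                                 *)
Inductive tword : Type :=
| Wgen of A & B
| Wzero
| Wadd of tword & tword
| Wopp of tword
| Wscale of K & tword
| Wlie of tword & tword.

Inductive tcong : tword -> tword -> Prop :=
| tc_refl u : tcong u u
| tc_sym u v : tcong u v -> tcong v u
| tc_trans u v w : tcong u v -> tcong v w -> tcong u w
| tc_add u u' v v' : tcong u u' -> tcong v v' -> tcong (Wadd u v) (Wadd u' v')
| tc_opp u u' : tcong u u' -> tcong (Wopp u) (Wopp u')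
| tc_scale k u u' : tcong u u' -> tcong (Wscale k u) (Wscale k u')
| tc_lie u u' v v' : tcong u u' -> tcong v v' -> tcong (Wlie u v) (Wlie u' v')
| tc_addA u v w : tcong (Wadd u (Wadd v w)) (Wadd (Wadd u v) w)
| tc_addC u v : tcong (Wadd u v) (Wadd v u)
| tc_add0 u : tcong (Wadd Wzero u) u
| tc_addN u : tcong (Wadd (Wopp u) u) Wzero
| tc_scaleA k l u : tcong (Wscale k (Wscale l u)) (Wscale (k * l) u)
| tc_scale1 u : tcong (Wscale 1 u) u
| tc_scaleDr k u v : tcong (Wscale k (Wadd u v)) (Wadd (Wscale k u) (Wscale k v))
| tc_scaleDl k l u : tcong (Wscale (k + l) u) (Wadd (Wscale k u) (Wscale l u))
| tc_lie_linl k u v w :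
    tcong (Wlie (Wadd (Wscale k u) v) w) (Wadd (Wscale k (Wlie u w)) (Wlie v w))
| tc_lie_linr k u v w :
    tcong (Wlie u (Wadd (Wscale k v) w)) (Wadd (Wscale k (Wlie u v)) (Wlie u w))
| tc_liexx u : tcong (Wlie u u) Wzero
| tc_jacobi u v w :
    tcong (Wadd (Wadd (Wlie u (Wlie v w)) (Wlie v (Wlie w u))) (Wlie w (Wlie u v)))
          Wzero
| tc_gen_linl k a a' b :
    tcong (Wgen (k *: a + a') b) (Wadd (Wscale k (Wgen a b)) (Wgen a' b))
| tc_gen_linr k a b b' :
    tcong (Wgen a (k *: b + b')) (Wadd (Wscale k (Wgen a b)) (Wgen a b'))
| tc_gen_liel a a' b :
    tcong (Wgen [lie a, a'] b) (Wadd (Wgen a (ab a' b)) (Wopp (Wgen a' (ab a b))))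
| tc_gen_lier a b b' :
    tcong (Wgen a [lie b, b']) (Wadd (Wgen (ba b' a) b) (Wopp (Wgen (ba b a) b')))
| tc_lie_gen a b a' b' :
    tcong (Wlie (Wgen a b) (Wgen a' b')) (Wopp (Wgen (ba b a) (ab a' b'))).

HB.instance Definition _ := gen_eqMixin tword.
HB.instance Definition _ := gen_choiceMixin tword.

Definition tcongb (u v : tword) : bool := `[< tcong u v >].

Fact tcongb_refl : reflexive tcongb.
Proof. by move=> u; apply/asboolP; exact: tc_refl. Qed.
Fact tcongb_sym : symmetric tcongb.
Proof. by move=> u v; apply/asboolP/asboolP; exact: tc_sym. Qed.
Fact tcongb_trans : transitive tcongb.
Proof.
by move=> v u w /asboolP uv /asboolP vw; apply/asboolP; exact: tc_trans uv vw.
Qed.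

Canonical tcong_equiv := EquivRel tcongb tcongb_refl tcongb_sym tcongb_trans.

Definition tensor : Type := {eq_quot tcong_equiv}.

HB.instance Definition _ := Choice.on tensor.
HB.instance Definition _ := EqQuotient.on tensor.

Definition tclass (u : tword) : tensor := \pi_tensor u.

Lemma tclassP u v : tclass u = tclass v <-> tcong u v.
Proof.
by split=> [/eqmodP/asboolP|/asboolP uv] //; apply/eqmodP.
Qed.

Lemma tclass_repr (x : tensor) : tclass (repr x) = x.
Proof. exact: reprK. Qed.

Lemma repr_tclass u : tcong (repr (tclass u)) u.
Proof. by apply/tclassP; rewrite tclass_repr. Qed.

Lemma tensorW (P : tensor -> Prop) : (forall u, P (tclass u)) -> forall x, P x.
Proof. by move=> Pc x; rewrite -(tclass_repr x). Qed.

Definition tzero := tclass Wzero.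
Definition tadd (x y : tensor) := tclass (Wadd (repr x) (repr y)).
Definition topp (x : tensor) := tclass (Wopp (repr x)).
Definition tscale k (x : tensor) := tclass (Wscale k (repr x)).
Definition tlie (x y : tensor) := tclass (Wlie (repr x) (repr y)).

Lemma taddE u v : tadd (tclass u) (tclass v) = tclass (Wadd u v).
Proof. by apply/tclassP/tc_add; exact: repr_tclass. Qed.
Lemma toppE u : topp (tclass u) = tclass (Wopp u).
Proof. by apply/tclassP/tc_opp; exact: repr_tclass. Qed.
Lemma tscaleE k u : tscale k (tclass u) = tclass (Wscale k u).
Proof. by apply/tclassP/tc_scale; exact: repr_tclass. Qed.
Lemma tlieE u v : tlie (tclass u) (tclass v) = tclass (Wlie u v).
Proof. by apply/tclassP/tc_lie; exact: repr_tclass. Qed.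

Fact taddA : associative tadd.
Proof.
by do 3![elim/tensorW=> ?]; rewrite !taddE; apply/tclassP/tc_addA.
Qed.
Fact taddC : commutative tadd.
Proof. by do 2![elim/tensorW=> ?]; rewrite !taddE; apply/tclassP/tc_addC. Qed.
Fact tadd0 : left_id tzero tadd.
Proof. by elim/tensorW=> ?; rewrite taddE; apply/tclassP/tc_add0. Qed.
Fact taddN : left_inverse tzero topp tadd.
Proof. by elim/tensorW=> ?; rewrite toppE taddE; apply/tclassP/tc_addN. Qed.

HB.instance Definition _ := GRing.isZmodule.Build tensor taddA taddC tadd0 taddN.

Fact tscaleA k l x : tscale k (tscale l x) = tscale (k * l) x.
Proof.
by elim/tensorW: x => ?; rewrite !tscaleE; apply/tclassP/tc_scaleA.
Qed.
Fact tscale1 : left_id 1 tscale.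
Proof. by elim/tensorW=> ?; rewrite tscaleE; apply/tclassP/tc_scale1. Qed.
Fact tscaleDr : right_distributive tscale +%R.
Proof.
move=> k; do 2![elim/tensorW=> ?]; rewrite /GRing.add /=.
by rewrite !(tscaleE, taddE); apply/tclassP/tc_scaleDr.
Qed.
Fact tscaleDl x : {morph tscale^~ x : k l / k + l}.
Proof.
elim/tensorW: x => u k l; rewrite [RHS]/GRing.add /=.
by rewrite !(tscaleE, taddE); apply/tclassP/tc_scaleDl.
Qed.

HB.instance Definition _ :=
  GRing.Zmodule_isLmodule.Build K tensor tscaleA tscale1 tscaleDr tscaleDl.

Lemma tclassD u v : tclass (Wadd u v) = tclass u + tclass v.
Proof. by rewrite -taddE. Qed.
Lemma tclassN u : tclass (Wopp u) = - tclass u.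
Proof. by rewrite -toppE. Qed.
Lemma tclassZ k u : tclass (Wscale k u) = k *: tclass u.
Proof. by rewrite -tscaleE. Qed.
Lemma tclass0 : tclass Wzero = 0. Proof. by []. Qed.

Fact tlie_bilinear : bilinear_for *:%R *:%R tlie.
Proof.
split=> z k x y; elim/tensorW: z => w; elim/tensorW: x => u;
  elim/tensorW: y => v;
  rewrite /= -tclassZ -tclassD !tlieE -tclassZ -tclassD;
  apply/tclassP; [exact: tc_lie_linl | exact: tc_lie_linr].
Qed.
Fact tliexx x : tlie x x = 0.
Proof. by elim/tensorW: x => u; rewrite tlieE; apply/tclassP/tc_liexx. Qed.
Fact tlie_jacobi x y z :
  tlie x (tlie y z) + tlie y (tlie z x) + tlie z (tlie x y) = 0.
Proof.
elim/tensorW: x => u; elim/tensorW: y => v; elim/tensorW: z => w.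
by rewrite !tlieE -!tclassD; apply/tclassP/tc_jacobi.
Qed.

HB.instance Definition _ :=
  Lmodule_isLieAlgebra.Build K tensor tlie_bilinear tliexx tlie_jacobi.

Lemma tclass_lie u v : tclass (Wlie u v) = [lie tclass u, tclass v].
Proof. by rewrite -tlieE. Qed.

Definition tens (a : A) (b : B) : tensor := tclass (Wgen a b).

Fact tens_bilinear : bilinear_for *:%R *:%R tens.
Proof.
split=> z k x y; rewrite /= /tens -tclassZ -tclassD; apply/tclassP;
  [exact: tc_gen_linl | exact: tc_gen_linr].
Qed.

HB.instance Definition _ :=
  bilinear_isBilinear.Build K A B tensor *:%R *:%R tens tens_bilinear.

Lemma tensDl a a' b : tens (a + a') b = tens a b + tens a' b.
Proof. exact: linearDl. Qed.
Lemma tensDr a b b' : tens a (b + b') = tens a b + tens a b'.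
Proof. exact: linearDr. Qed.
Lemma tensZl k a b : tens (k *: a) b = k *: tens a b.
Proof. exact: linearZl_LR. Qed.
Lemma tensZr k a b : tens a (k *: b) = k *: tens a b.
Proof. exact: linearZr_LR. Qed.
Lemma tensNl a b : tens (- a) b = - tens a b. Proof. exact: linearNl. Qed.
Lemma tensNr a b : tens a (- b) = - tens a b. Proof. exact: linearNr. Qed.

Lemma tens0l b : tens 0 b = 0. Proof. exact: linear0l. Qed.

Lemma tens_liel a a' b : tens [lie a, a'] b = tens a (ab a' b) - tens a' (ab a b).
Proof. by rewrite /tens -tclassN -tclassD; apply/tclassP/tc_gen_liel. Qed.
Lemma tens_lier a b b' : tens a [lie b, b'] = tens (ba b' a) b - tens (ba b a) b'.
Proof. by rewrite /tens -tclassN -tclassD; apply/tclassP/tc_gen_lier. Qed.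
Lemma lie_tens a b a' b' : [lie tens a b, tens a' b'] = - tens (ba b a) (ab a' b').
Proof. by rewrite /tens -tclassN -tclass_lie; apply/tclassP/tc_lie_gen. Qed.

Lemma tens_ind (P : tensor -> Prop) :
    (forall a b, P (tens a b)) -> P 0 -> (forall x y, P x -> P y -> P (x + y)) ->
  (forall k x, P x -> P (k *: x)) -> forall x, P x.
Proof.
pose lin (Q : tensor -> Prop) :=
  [/\ Q 0, forall x y, Q x -> Q y -> Q (x + y) & forall k x, Q x -> Q (k *: x)].
pose span x := forall Q, lin Q -> (forall a b, Q (tens a b)) -> Q x.
have spanL : lin span.
  split; first by move=> Q [].
    move=> x y Sx Sy Q LQ Qt; case: (LQ) => _ QD _.
    by apply: QD; [exact: Sx|exact: Sy].
  by move=> k x Sx Q LQ Qt; case: (LQ) => _ _; apply; exact: Sx.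
have span_lie x y : span x -> span y -> span [lie x, y].
  move=> Sx Sy; case: (spanL) => S0 SD SZ.
  apply: (Sx (fun t => span [lie t, y])) => [|a b].
    split=> [|t z St Sz|k t St]; first by rewrite lie0l.
      by rewrite lieDl; apply: SD.
    by rewrite lieZl; apply: SZ.
  apply: (Sy (fun t => span [lie tens a b, t])) => [|a' b'].
    split=> [|t z St Sz|k t St]; first by rewrite lie0r.
      by rewrite lieDr; apply: SD.
    by rewrite lieZr; apply: SZ.
  by rewrite lie_tens -scaleN1r; apply: SZ => Q _ Qt; exact: Qt.
move=> Pt P0 PD PZ x; suff Sx : span x by apply: Sx.
case: (spanL) => S0 SD SZ; elim/tensorW: x.
elim=> [a b||u IHu v IHv|u IHu|k u IHu|u IHu v IHv].
- by move=> Q _ Qt; exact: Qt.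
- exact: S0.
- by rewrite tclassD; apply: SD.
- by rewrite tclassN -scaleN1r; apply: SZ.
- by rewrite tclassZ; apply: SZ.
- by rewrite tclass_lie; apply: span_lie.
Qed.

Section Lift.
Variables (L : lieAlgType K) (f : {bilinear A -> B -> L}).
Hypothesis f_liel : forall a a' b, f [lie a, a'] b = f a (ab a' b) - f a' (ab a b).
Hypothesis f_lier : forall a b b', f a [lie b, b'] = f (ba b' a) b - f (ba b a) b'.
Hypothesis lie_f : forall a b a' b',
  [lie f a b, f a' b'] = - f (ba b a) (ab a' b').

Fixpoint weval (u : tword) : L :=
  match u with
  | Wgen a b => f a b
  | Wzero => 0
  | Wadd u v => weval u + weval v
  | Wopp u => - weval u
  | Wscale k u => k *: weval u
  | Wlie u v => [lie weval u, weval v]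
  end.

Lemma weval_cong u v : tcong u v -> weval u = weval v.
Proof.
elim=> //=; do ?by [move=> *; congruence].
- by move=> *; rewrite addrA.
- by move=> *; rewrite addrC.
- by move=> *; rewrite add0r.
- by move=> *; rewrite addNr.
- by move=> *; rewrite scalerA.
- by move=> *; rewrite scale1r.
- by move=> *; rewrite scalerDr.
- by move=> *; rewrite scalerDl.
- by move=> *; rewrite lieDl lieZl.
- by move=> *; rewrite lieDr lieZr.
- by move=> *; rewrite liexx.
- by move=> *; rewrite lie_jacobi.
- by move=> *; rewrite linearDl linearZl_LR.
- by move=> *; rewrite linearDr linearZr_LR.
Qed.

Definition tlift_fun (x : tensor) : L := weval (repr x).

Lemma tlift_class u : tlift_fun (tclass u) = weval u.
Proof. exact/weval_cong/repr_tclass. Qed.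

Fact tlift_linear : linear tlift_fun.
Proof.
move=> k x y; elim/tensorW: x => u; elim/tensorW: y => v.
by rewrite -tclassZ -tclassD !tlift_class.
Qed.

HB.instance Definition _ :=
  GRing.isLinear.Build K tensor L *:%R tlift_fun tlift_linear.

Fact tlift_lie x y : tlift_fun [lie x, y] = [lie tlift_fun x, tlift_fun y].
Proof.
elim/tensorW: x => u; elim/tensorW: y => v.
by rewrite -tclass_lie !tlift_class.
Qed.

Definition tlift : lieHom tensor L := LieHom tlift_lie.

Lemma tlift_tens a b : tlift (tens a b) = f a b.
Proof. exact: tlift_class. Qed.

End Lift.

Section Derivation.
Variables (d : A -> A) (e : B -> B).
Hypotheses (d_linear : linear d) (e_linear : linear e).
Hypothesis d_lie : forall a a', d [lie a, a'] = [lie d a, a'] + [lie a, d a'].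
Hypothesis e_lie : forall b b', e [lie b, b'] = [lie e b, b'] + [lie b, e b'].
Hypothesis e_ab : forall a b, e (ab a b) = ab (d a) b + ab a (e b).
Hypothesis d_ba : forall b a, d (ba b a) = ba (e b) a + ba b (d a).

Fixpoint wder (u : tword) : tensor :=
  match u with
  | Wgen a b => tens (d a) b + tens a (e b)
  | Wzero => 0
  | Wadd u v => wder u + wder v
  | Wopp u => - wder u
  | Wscale k u => k *: wder u
  | Wlie u v => [lie wder u, tclass v] + [lie tclass u, wder v]
  end.

Lemma wder_cong u v : tcong u v -> wder u = wder v.
Proof.
elim=> /=; do ?by [move=> *; congruence].
- by move=> ? ? ? ? /tclassP -> -> /tclassP -> ->.
- by move=> *; rewrite addrA.
- by move=> *; rewrite addrC.
- by move=> *; rewrite add0r.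
- by move=> *; rewrite addNr.
- by move=> *; rewrite scalerA.
- by move=> *; rewrite scale1r.
- by move=> *; rewrite scalerDr.
- by move=> *; rewrite scalerDl.
- by move=> *; rewrite tclassD tclassZ !lieDl !lieZl scalerDr addrACA.
- by move=> *; rewrite tclassD tclassZ !lieDr !lieZr scalerDr addrACA.
- by move=> t; rewrite lieC addNr.
- move=> t u' v'; rewrite !tclass_lie !lieDr.
  set T := tclass t; set U := tclass u'; set V := tclass v'.
  have JT := lie_jacobi (wder t) U V; have JU := lie_jacobi T (wder u') V.
  have JV := lie_jacobi T U (wder v').
  rewrite [LHS](AC ((1*2)*(1*2)*(1*2)) ((1*6*8)*(2*4*9)*(3*5*7))) /=.
  by rewrite JT JU JV !addr0.
- move=> k a a' b.
  by rewrite d_linear !(tensDl, tensZl) scalerDr addrACA.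
- move=> k a b b'.
  by rewrite e_linear !(tensDr, tensZr) scalerDr addrACA.
- move=> a a' b; rewrite d_lie tensDl !tens_liel !e_ab !tensDr !opprD.
  by rewrite [LHS](AC (2*2*2) (1*(3*5)*(4*(2*6)))) .
- move=> a b b'; rewrite e_lie tensDr !tens_lier !d_ba !tensDl !opprD.
  by rewrite [LHS](AC (2*(2*2)) ((5*1*3)*((4*2)*6))).
- move=> a b a' b'; rewrite lieDl lieDr !lie_tens d_ba e_ab tensDl tensDr !opprD.
  by rewrite [X in X + _ = _]addrC.
Qed.

Definition tder (x : tensor) : tensor := wder (repr x).

Lemma tder_class u : tder (tclass u) = wder u.
Proof. exact/wder_cong/repr_tclass. Qed.

Lemma tder_linear : linear tder.
Proof.
move=> k x y; elim/tensorW: x => u; elim/tensorW: y => v.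
by rewrite -tclassZ -tclassD !tder_class.
Qed.

Lemma tder_lie x y : tder [lie x, y] = [lie tder x, y] + [lie x, tder y].
Proof.
elim/tensorW: x => u; elim/tensorW: y => v.
by rewrite -tclass_lie !tder_class.
Qed.

Lemma tder_tens a b : tder (tens a b) = tens (d a) b + tens a (e b).
Proof. exact: tder_class. Qed.

End Derivation.

End NonabelianTensor.

Arguments tens {K A B ab ba} a b.

Section TensorCrossedModule.
Variables (K : fieldType) (M N : lieAlgType K) (X : crossedModule M N).

Definition bd_act (m : M) (n : N) : N := [lie xm_bd X m, n].

Fact bd_act_bilinear : bilinear_for *:%R *:%R bd_act.
Proof.
by split=> z k x y; rewrite /= /bd_act ?linearP ?lieDl ?lieDr ?lieZl ?lieZr.
Qed.

HB.instance Definition _ :=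
  bilinear_isBilinear.Build K M N N *:%R *:%R bd_act bd_act_bilinear.

Fact bd_act_liel m m' n :
  bd_act [lie m, m'] n = bd_act m (bd_act m' n) - bd_act m' (bd_act m n).
Proof. by rewrite /bd_act lie_homP lie_liel. Qed.

Fact bd_act_lier m n n' :
  bd_act m [lie n, n'] = [lie bd_act m n, n'] + [lie n, bd_act m n'].
Proof. exact: lie_lier. Qed.

Definition bd_action : lieAction M N := LieAction bd_act_liel bd_act_lier.

Definition tensNN : lieAlgType K := tensor (adj_action N) (adj_action N).
Definition tensNM : lieAlgType K := tensor (xm_act X) bd_action.

Fact commutator_liel (a a' b : N) :
  [lie [lie a, a'], b] = [lie a, adj_action N a' b] - [lie a', adj_action N a b].
Proof. exact: lie_liel. Qed.
Fact commutator_lier (a b b' : N) :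
  [lie a, [lie b, b']] = [lie adj_action N b' a, b] - [lie adj_action N b a, b'].
Proof.
by rewrite /= lie_lier addrC (lieC b) (lieC a b') (lieC a b) !lieNl opprK.
Qed.
Fact commutator_lie (a b a' b' : N) :
  [lie [lie a, b], [lie a', b']] = - [lie adj_action N b a, adj_action N a' b'].
Proof. by rewrite /= (lieC b) lieNl opprK. Qed.

Definition commutator : lieHom tensNN N :=
  tlift commutator_liel commutator_lier commutator_lie.

Arguments commutator : simpl never.

Lemma commutator_tens n n' : commutator (tens n n') = [lie n, n'].
Proof. exact: tlift_tens. Qed.

Definition tens_bd_gen (n : N) (m : M) : tensNN := tens n (xm_bd X m).

Fact tens_bd_bilinear : bilinear_for *:%R *:%R tens_bd_gen.
Proof.
by split=> z k x y; rewrite /= /tens_bd_gen ?linearP;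
  rewrite ?tensDl ?tensDr ?tensZl ?tensZr.
Qed.

HB.instance Definition _ :=
  bilinear_isBilinear.Build K N M tensNN *:%R *:%R tens_bd_gen tens_bd_bilinear.

Fact tens_bd_liel a a' b :
  tens_bd_gen [lie a, a'] b =
  tens_bd_gen a (xm_act X a' b) - tens_bd_gen a' (xm_act X a b).
Proof. by rewrite /tens_bd_gen !xm_equivariant tens_liel. Qed.
Fact tens_bd_lier a b b' :
  tens_bd_gen a [lie b, b'] =
  tens_bd_gen (bd_action b' a) b - tens_bd_gen (bd_action b a) b'.
Proof. by rewrite /tens_bd_gen lie_homP tens_lier. Qed.
Fact lie_tens_bd a b a' b' :
  [lie tens_bd_gen a b, tens_bd_gen a' b'] =
  - tens_bd_gen (bd_action b a) (xm_act X a' b').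
Proof. by rewrite /tens_bd_gen lie_tens xm_equivariant. Qed.

Definition tens_bd : lieHom tensNM tensNN :=
  tlift tens_bd_liel tens_bd_lier lie_tens_bd.

Arguments tens_bd : simpl never.

Lemma tens_bdE n m : tens_bd (tens n m) = tens n (xm_bd X m).
Proof. exact: tlift_tens. Qed.

(* The action * of N (x) N on N (x) M: x acts as the derivation induced by    *)
(* the actions of its commutator on N and on M.                               *)
Definition tens_act (x : tensNN) (y : tensNM) : tensNM :=
  tder (lie_br (commutator x)) (xm_act X (commutator x)) y.

Section Diagonal.
Variable c : N.
Fact lie_c_linear : linear (lie_br c). Proof. exact: linearPr. Qed.
Fact act_c_linear : linear (xm_act X c). Proof. exact: linearPr. Qed.
Fact diag_e_ab (n : N) (m : M) :
  xm_act X c (xm_act X n m) = xm_act X [lie c, n] m + xm_act X n (xm_act X c m).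
Proof. by rewrite act_liel subrK. Qed.
Fact diag_d_ba (m : M) (n : N) :
  [lie c, bd_action m n] = bd_action (xm_act X c m) n + bd_action m [lie c, n].
Proof. by rewrite /= /bd_act xm_equivariant lie_lier. Qed.
Definition diag_linear :=
  tder_linear (lie_c_linear) act_c_linear (lie_lier c) (act_lier (xm_act X) c)
    diag_e_ab diag_d_ba.
Definition diag_lie :=
  tder_lie (lie_c_linear) act_c_linear (lie_lier c) (act_lier (xm_act X) c)
    diag_e_ab diag_d_ba.
Definition diag_tens :=
  tder_tens (lie_c_linear) act_c_linear (lie_lier c) (act_lier (xm_act X) c)
    diag_e_ab diag_d_ba.
End Diagonal.

Lemma tens_act_tens x n m :
  tens_act x (tens n m) =
  tens [lie commutator x, n] m + tens n (xm_act X (commutator x) m).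
Proof. exact: diag_tens. Qed.

Lemma tens_actE n n' n'' m :
  tens_act (tens n n') (tens n'' m) =
  tens [lie [lie n, n'], n''] m + tens n'' (xm_act X [lie n, n'] m).
Proof. by rewrite tens_act_tens commutator_tens. Qed.

Fact tens_act0r x : tens_act x 0 = 0.
Proof.
have := diag_linear (commutator x) (-1) 0 0.
by rewrite scaler0 addr0 scaleN1r addNr.
Qed.
Fact tens_actDr x y z : tens_act x (y + z) = tens_act x y + tens_act x z.
Proof. by have := diag_linear (commutator x) 1 y z; rewrite !scale1r. Qed.
Fact tens_actZr k x y : tens_act x (k *: y) = k *: tens_act x y.
Proof.
rewrite -[k *: y]addr0 /tens_act diag_linear.
by rewrite -/(tens_act x 0) tens_act0r addr0.
Qed.

Fact tens_act_bilinear : bilinear_for *:%R *:%R tens_act.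
Proof.
split=> z; last exact: diag_linear.
move=> k x y; rewrite /=; elim/tens_ind: z => [n m||z t Hz Ht|l z Hz].
- rewrite !tens_act_tens linearP lieDl lieZl actDl actZl.
  by rewrite tensDl tensDr tensZl tensZr scalerDr addrACA.
- by rewrite !tens_act0r scaler0 addr0.
- by rewrite !tens_actDr Hz Ht scalerDr addrACA.
- by rewrite !tens_actZr Hz scalerDr !scalerA (mulrC k).
Qed.

HB.instance Definition _ :=
  bilinear_isBilinear.Build K tensNN tensNM tensNM *:%R *:%R tens_act
    tens_act_bilinear.

Lemma tens_actDl x y z : tens_act (x + y) z = tens_act x z + tens_act y z.
Proof. exact: linearDl. Qed.
Lemma tens_actZl k x y : tens_act (k *: x) y = k *: tens_act x y.
Proof. exact: linearZl_LR. Qed.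
Lemma tens_act0l y : tens_act 0 y = 0.
Proof. exact: linear0l. Qed.

Fact tens_act_liel x x' y :
  tens_act [lie x, x'] y = tens_act x (tens_act x' y) - tens_act x' (tens_act x y).
Proof.
elim/tens_ind: y => [n m||y z Hy Hz|k y Hy].
- rewrite !tens_act_tens !tens_actDr !tens_act_tens lie_homP act_liel lie_liel.
  rewrite !tensDl !tensDr !tensNl !tensNr !opprD.
  rewrite [RHS](AC (2*2*(2*2)) (((1*5)*(4*8))*((2*7)*(3*6)))) /=.
  by rewrite !subrr !addr0.
- by rewrite !tens_act0r subr0.
- by rewrite !tens_actDr Hy Hz opprD addrACA.
- by rewrite !tens_actZr Hy scalerBr.
Qed.

Fact tens_act_lier x y y' :
  tens_act x [lie y, y'] = [lie tens_act x y, y'] + [lie y, tens_act x y'].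
Proof. exact: diag_lie. Qed.

Definition tens_action : lieAction tensNN tensNM :=
  LieAction tens_act_liel tens_act_lier.

Lemma lie_tensNN x n n' :
  [lie x, (tens n n' : tensNN)] = tens (commutator x) [lie n, n'].
Proof.
elim/tens_ind: x => [a b||x y Hx Hy|k x Hx].
- by rewrite lie_tens commutator_tens /= (lieC a b) tensNl.
- by rewrite lie0l lhom0 tens0l.
- by rewrite lieDl lhomD tensDl Hx Hy.
- by rewrite lieZl lhomZ tensZl Hx.
Qed.

Fact tens_equivariant x y : tens_bd (tens_action x y) = [lie x, tens_bd y].
Proof.
rewrite -[tens_action x y]/(tens_act x y).
elim/tens_ind: y => [n m||y z Hy Hz|k y Hy].
- rewrite tens_act_tens lhomD. rewrite !tens_bdE lie_tensNN xm_equivariant.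
  by rewrite tens_liel subrK.
- by rewrite tens_act0r lhom0 lie0r.
- by rewrite tens_actDr !lhomD lieDr Hy Hz.
- by rewrite tens_actZr !lhomZ lieZr Hy.
Qed.

Fact tens_peiffer x y : tens_action (tens_bd x) y = [lie x, y].
Proof.
rewrite -[tens_action _ _]/(tens_act _ _).
elim/tens_ind: x => [a b||x z Hx Hz|k x Hx].
- elim/tens_ind: y => [n m||y z Hy Hz|k y Hy].
  + rewrite tens_bdE tens_actE lie_tens tens_liel subrK.
    by rewrite (lieC a) tensNl.
  + by rewrite tens_act0r lie0r.
  + by rewrite tens_actDr lieDr Hy Hz.
  + by rewrite tens_actZr lieZr Hy.
- by rewrite lhom0 tens_act0l lie0l.
- by rewrite lhomD tens_actDl lieDl Hx Hz.
- by rewrite lhomZ tens_actZl lieZl Hx.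
Qed.

Definition tens_crossedModule : crossedModule tensNM tensNN :=
  CrossedModule tens_equivariant tens_peiffer.

End TensorCrossedModule.

(* Main.v *)
(* A braiding on (M -> N) factors through N (x) N as a Lie homomorphism beta  *)
(* lifting the commutator map c : N (x) N -> N along the boundary M -> N. The *)
(* map sought is then (x, y) |-> c(x) (x) beta(y), and the braiding axioms    *)
(* follow from the defining relations of N (x) M.                             *)
From HB Require Import structures.
Require Import Defs.
From mathcomp Require Import all_boot all_order all_algebra.
From mathcomp Require Import sesquilinear boolp.

Set Implicit Arguments.
Unset Strict Implicit.
Unset Printing Implicit Defensive.

Import GRing.Theory.
Local Open Scope ring_scope.

Lemma tens_bilinear_ext (K : fieldType) (A B C D : lieAlgType K)
    (ab : lieAction A B) (ba : lieAction B A)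
    (cd : lieAction C D) (dc : lieAction D C) (V : lmodType K)
    (f g : {bilinear tensor ab ba -> tensor cd dc -> V}) :
  (forall a b c d, f (tens a b) (tens c d) = g (tens a b) (tens c d)) ->
  forall x y, f x y = g x y.
Proof.
move=> fg x; elim/tens_ind=> [c d||y z fy fz|k y fy].
- elim/tens_ind: x => [//||x y fx fy|k x fx].
  + by rewrite !linear0l.
  + by rewrite !linearDl fx fy.
  + by rewrite !linearZl_LR fx.
- by rewrite !linear0r.
- by rewrite !linearDr fy fz.
- by rewrite !linearZr_LR fy.
Qed.

Lemma lie_tensNN_commutator (K : fieldType) (N : lieAlgType K) (x y : tensNN N) :
  [lie x, y] = tens (commutator N x) (commutator N y).
Proof.
elim/tens_ind: y => [n n'||y z IHy IHz|k y IHy].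
- by rewrite commutator_tens lie_tensNN.
- by rewrite lie0r linear0 linear0r.
- by rewrite lieDr linearD tensDr IHy IHz.
- by rewrite lieZr linearZ tensZr IHy.
Qed.

Section TensorBraiding.
Variables (K : fieldType) (M N : lieAlgType K) (X : crossedModule M N).
Variables (br : {bilinear N -> N -> M}) (brP : is_braiding X br).

Fact braid_tens_liel (a a' b : N) :
  br [lie a, a'] b = br a (adj_action N a' b) - br a' (adj_action N a b).
Proof. exact: braid_liel brP a a' b. Qed.

Fact braid_tens_lier (a b b' : N) :
  br a [lie b, b'] = br (adj_action N b' a) b - br (adj_action N b a) b'.
Proof.
by rewrite (braid_lier brP) addrC (lieC a b) (lieC a b') !linearNl opprK.
Qed.

Fact lie_braid_tens (a b a' b' : N) :
  [lie br a b, br a' b'] = - br (adj_action N b a) (adj_action N a' b').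
Proof.
by rewrite -(braid_bdbd brP) !(bd_braid brP) (lieC a b) linearNl.
Qed.

Definition braid_lift : lieHom (tensNN N) M :=
  tlift braid_tens_liel braid_tens_lier lie_braid_tens.

Arguments braid_lift : simpl never.

Lemma braid_lift_tens n n' : braid_lift (tens n n') = br n n'.
Proof. exact: tlift_tens. Qed.

Lemma bd_braid_lift x : xm_bd X (braid_lift x) = commutator N x.
Proof.
elim/tens_ind: x => [n n'||x y IHx IHy|k x IHx].
- by rewrite braid_lift_tens commutator_tens (bd_braid brP).
- by rewrite !linear0.
- by rewrite !linearD IHx IHy.
- by rewrite !linearZ IHx.
Qed.

Definition tens_braid (x y : tensNN N) : tensNM X :=
  tens (commutator N x) (braid_lift y).

Fact tens_braid_bilinear : bilinear_for *:%R *:%R tens_braid.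
Proof.
by split=> z k x y; rewrite /= /tens_braid linearP;
  [rewrite tensDl tensZl | rewrite tensDr tensZr].
Qed.

HB.instance Definition _ :=
  bilinear_isBilinear.Build K (tensNN N) (tensNN N) (tensNM X) *:%R *:%R
    tens_braid tens_braid_bilinear.

Lemma tens_braidDl x y z : tens_braid (x + y) z = tens_braid x z + tens_braid y z.
Proof. exact: linearDl. Qed.
Lemma tens_braidDr x y z : tens_braid x (y + z) = tens_braid x y + tens_braid x z.
Proof. exact: linearDr. Qed.
Lemma tens_braidZl k x y : tens_braid (k *: x) y = k *: tens_braid x y.
Proof. exact: linearZl_LR. Qed.
Lemma tens_braidZr k x y : tens_braid x (k *: y) = k *: tens_braid x y.
Proof. exact: linearZr_LR. Qed.

Lemma tens_braid_tens n n' n'' n''' :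
  tens_braid (tens n n') (tens n'' n''') = tens [lie n, n'] (br n'' n''').
Proof. by rewrite /tens_braid commutator_tens braid_lift_tens. Qed.

Lemma tens_braid_bdl y x :
  tens_braid (tens_bd X y) x = - tens_act x y.
Proof.
elim/tens_ind: y => [n m||y z IHy IHz|k y IHy].
- rewrite /tens_braid tens_bdE commutator_tens tens_act_tens -bd_braid_lift.
  rewrite xm_peiffer tens_lier /= /bd_act addrCA subrr addr0.
  by rewrite lieC tensNl.
- by rewrite tens_act0r lhom0 linear0l oppr0.
- by rewrite tens_actDr lhomD tens_braidDl IHy IHz opprD.
- by rewrite tens_actZr lhomZ tens_braidZl IHy scalerN.
Qed.

Lemma tens_braid_bdr x y :
  tens_braid x (tens_bd X y) = tens_act x y.
Proof.
elim/tens_ind: y => [n m||y z IHy IHz|k y IHy].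
- rewrite /tens_braid tens_bdE braid_lift_tens (braid_bdr brP) tens_act_tens.
  by rewrite tens_liel subrK.
- by rewrite tens_act0r lhom0 linear0r.
- by rewrite tens_actDr lhomD tens_braidDr IHy IHz.
- by rewrite tens_actZr lhomZ tens_braidZr IHy.
Qed.

Lemma tens_braidP : is_braiding (tens_crossedModule X) tens_braid.
Proof.
split=> [x y|x y|y x|x y|x y z|x y z] /=.
- by rewrite /tens_braid tens_bdE bd_braid_lift lie_tensNN_commutator.
- by rewrite tens_braid_bdr -tens_peiffer.
- exact: tens_braid_bdl.
- exact: tens_braid_bdr.
- rewrite /tens_braid !lie_homP tens_lier /= /bd_act !bd_braid_lift.
  by rewrite addrC lieC tensNl opprK (lieC (commutator N z)) tensNl.
- rewrite /tens_braid !lie_homP tens_liel.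
  by rewrite -!(xm_peiffer X) !bd_braid_lift.
Qed.

End TensorBraiding.

Theorem proposition3p1 (K : fieldType) (M N : lieAlgType K)
    (X : crossedModule M N) (br : {bilinear N -> N -> M}) :
  is_braiding X br ->
  exists tbr : {bilinear (tensNN N) -> (tensNN N) -> (tensNM X)},
    [/\ forall n n' n'' n''' : N,
          tbr (tens n n') (tens n'' n''') = tens [lie n, n'] (br n'' n'''),
        forall tbr' : {bilinear (tensNN N) -> (tensNN N) -> (tensNM X)},
          (forall n n' n'' n''' : N,
            tbr' (tens n n') (tens n'' n''') = tens [lie n, n'] (br n'' n''')) ->
          forall x y, tbr' x y = tbr x y
      & is_braiding (tens_crossedModule X) tbr].
Proof.
move=> brP; exists (tens_braid brP); split; last exact: tens_braidP.
  exact: tens_braid_tens.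
move=> tbr' tbr'E; apply: tens_bilinear_ext => n n' n'' n'''.
by rewrite tbr'E; apply/esym/tens_braid_tens.
Qed.
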